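(* Let $K_1$ be the virtual trefoil knot, i.e. the closure of the virtual braid $\sigma_1^{-2}\rho_1\in VB_2$, and let $G(K_1)=G_A(K_1)$ be its group. Then $G(K_1)$ is residually nilpotent.
   Context: A nontrivial group $G$ is residually nilpotent if for every $1\ne g\in G$ there are a nilpotent group $N$ and a homomorphism $\varphi:G\to N$ with $\varphi(g)\ne1$. Conjugation: $x^{y}=y^{-1}xy$. $VB_2$ is generated by $\sigma_1,\rho_1$ with the relation $\rho_1^2=1$. The representation $\varphi_A:VB_2\to\operatorname{Aut}(\langle x_1,x_2,y\rangle)$ (automorphisms of the free group of rank 3) is: $\varphi_A(\sigma_1): x_1\mapsto x_1x_2x_1^{-1},\ x_2\mapsto x_1,\ y\mapsto y$; $\varphi_A(\rho_1): x_1\mapsto x_2^{y^{-1}},\ x_2\mapsto x_1^{y},\ y\mapsto y$. Automorphisms act on the right (in a braid word the automorphism of the leftmost letter is applied first). For a virtual link $K$ that is the closure of $\beta\in VB_2$, $G_A(K)=\langle x_1,x_2,y\mid x_i=\varphi_A(\beta)(x_i),\ i=1,2\rangle$. Explicitly, for $\beta=\sigma_1^{-2}\rho_1$, $$G(K_1)=\langle x_1,x_2,y\mid x_1=y^{-1}x_1^{-1}y^2x_2y^{-2}x_1y,\ \ x_2=y^{-1}x_1^{-1}y^2x_2^{-1}y^{-2}x_1y\cdot yx_2y^{-2}x_1y\rangle.$$ *)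

(* Defs.v *)
From HB Require Import structures.
From mathcomp Require Import all_boot generic_quotient.
From mathcomp Require Import boolp classical_sets.

Set Implicit Arguments.
Unset Strict Implicit.
Unset Printing Implicit Defensive.

Import Algebra.

Local Open Scope quotient_scope.
Local Open Scope classical_set_scope.
Local Open Scope group_scope.

(* Groups are MathComp's [groupType]s: possibly infinite, with
   [x ^ y = y^-1 * (x * y)] and [[~ x, y] = x^-1 * (y^-1 * (x * y))].
   Group homomorphisms are MathComp's unital multiplicative maps. *)
Notation "{ 'hom' G -> H }" := (UMagmaMorphism.type G%type H%type)
  (at level 0, G at level 98, H at level 99,
   format "{ 'hom'  G  ->  H }") : type_scope.

Lemma group_monoid_morphism (G H : groupType) (f : G -> H) :
  {morph f : x y / x * y} -> monoid_morphism f.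
Proof. by move=> fM; split=> //; apply: (mulgI (f 1)); rewrite -fM !mulg1. Qed.

Inductive generated (G : groupType) (A : set G) : set G :=
| gen_in x : A x -> generated A x
| gen_1 : generated A 1
| gen_M x y : generated A x -> generated A y -> generated A (x * y)
| gen_V x : generated A x -> generated A x^-1.

Definition normal_closure (G : groupType) (R : set G) : set G :=
  generated [set r ^ g | r in R & g in [set: G]].

(* [lower_central G n] is gamma_(n+1)(G). *)
Fixpoint lower_central (G : groupType) (n : nat) : set G :=
  if n is m.+1
  then generated [set [~ x, y] | x in lower_central m & y in [set: G]]
  else [set: G].

Arguments lower_central : clear implicits.

Definition nilpotent_group (G : groupType) : Prop :=
  exists c, lower_central G c = [set 1].

Definition residually_nilpotent (G : groupType) : Prop :=
  (exists g : G, g <> 1) /\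
  forall g : G, g <> 1 ->
    exists (N : groupType) (phi : {hom G -> N}),
      nilpotent_group N /\ phi g <> 1.

Section FreeGroup.
Variable X : choiceType.

(* The letter [(x, false)] stands for x and [(x, true)] for its inverse. *)
Definition word := seq (X * bool).

Inductive free_eq : word -> word -> Prop :=
| free_eq_cancel u v x b :
    free_eq (u ++ [:: (x, b), (x, ~~ b) & v]) (u ++ v)
| free_eq_refl u : free_eq u u
| free_eq_sym u v : free_eq u v -> free_eq v u
| free_eq_trans u v w : free_eq u v -> free_eq v w -> free_eq u w.

Definition free_eqb (u v : word) : bool := `[< free_eq u v >].

Fact free_eqb_refl : reflexive free_eqb.
Proof. by move=> u; apply/asboolP; exact: free_eq_refl. Qed.

Fact free_eqb_sym : symmetric free_eqb.
Proof. by move=> u v; apply/asboolP/asboolP; exact: free_eq_sym. Qed.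

Fact free_eqb_trans : transitive free_eqb.
Proof.
by move=> v u w /asboolP uv /asboolP vw; apply/asboolP; exact: free_eq_trans vw.
Qed.

Canonical free_eqb_equiv :=
  EquivRel free_eqb free_eqb_refl free_eqb_sym free_eqb_trans.

Definition free_group := {eq_quot free_eqb}.
HB.instance Definition _ := EqQuotient.on free_group.
HB.instance Definition _ := Choice.on free_group.

Definition free_class (u : word) : free_group := \pi_free_group u.

Lemma free_classP u v : free_class u = free_class v <-> free_eq u v.
Proof.
split=> [/eqmodP/asboolP //|uv]; apply/eqmodP; exact/asboolP.
Qed.

Lemma free_classK (g : free_group) : free_class (repr g) = g.
Proof. exact: reprK. Qed.

Lemma free_eq_cat u u' v v' :
  free_eq u u' -> free_eq v v' -> free_eq (u ++ v) (u' ++ v').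
Proof.
move=> uu' vv'; apply: (@free_eq_trans _ (u' ++ v)).
  elim: uu' => {u u'} [a b x e|a|a b _|a b c _ ab _ bc].
  - by rewrite -!catA /=; exact: free_eq_cancel.
  - exact: free_eq_refl.
  - exact: free_eq_sym.
  - exact: free_eq_trans bc.
elim: vv' => {v v'} [a b x e|a|a b _|a b c _ ab _ bc].
- by rewrite !catA; exact: free_eq_cancel.
- exact: free_eq_refl.
- exact: free_eq_sym.
- exact: free_eq_trans bc.
Qed.

Definition word_inv (u : word) : word := rev [seq (l.1, ~~ l.2) | l <- u].

Lemma word_inv_cat u v : word_inv (u ++ v) = word_inv v ++ word_inv u.
Proof. by rewrite /word_inv map_cat rev_cat. Qed.

Lemma word_invK : involutive word_inv.
Proof.
move=> u; rewrite /word_inv map_rev revK -map_comp -[RHS]map_id.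
by apply: eq_map => -[x b] /=; rewrite negbK.
Qed.

Lemma free_eq_inv u v : free_eq u v -> free_eq (word_inv u) (word_inv v).
Proof.
elim=> {u v} [a b x e|a|a b _|a b c _ ab _ bc].
- rewrite !word_inv_cat -[_ :: _ :: b]/([:: (x, e); (x, ~~ e)] ++ b).
  rewrite word_inv_cat -catA /word_inv /= negbK; exact: free_eq_cancel.
- exact: free_eq_refl.
- exact: free_eq_sym.
- exact: free_eq_trans bc.
Qed.

Lemma free_eq_catV u : free_eq (u ++ word_inv u) [::].
Proof.
elim: u => [|[x b] u IHu]; first exact: free_eq_refl.
rewrite -cat1s word_inv_cat -catA [u ++ _]catA.
have /(free_eq_cat (free_eq_refl [:: (x, b)])) : 
    free_eq ((u ++ word_inv u) ++ word_inv [:: (x, b)]) (word_inv [:: (x, b)]).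
  by rewrite -[X in free_eq _ X]cat0s; apply: free_eq_cat (free_eq_refl _).
move=> /free_eq_trans; apply.
exact: (@free_eq_cancel [::] [::] x b).
Qed.

Definition free_mul (g h : free_group) := free_class (repr g ++ repr h).
Definition free_one := free_class [::].
Definition free_inv (g : free_group) := free_class (word_inv (repr g)).

Lemma free_mulE u v :
  free_mul (free_class u) (free_class v) = free_class (u ++ v).
Proof.
by apply/free_classP/free_eq_cat; apply/free_classP; rewrite free_classK.
Qed.

Lemma free_invE u : free_inv (free_class u) = free_class (word_inv u).
Proof. by apply/free_classP/free_eq_inv/free_classP; rewrite free_classK. Qed.

Fact free_mulA : associative free_mul.
Proof.
move=> f g h.
by rewrite -[f]free_classK -[g]free_classK -[h]free_classK !free_mulE catA.
Qed.

Fact free_mul1 : left_id free_one free_mul.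
Proof. by move=> g; rewrite -[g]free_classK free_mulE. Qed.

Fact free_1mul : right_id free_one free_mul.
Proof. by move=> g; rewrite -[g]free_classK free_mulE cats0. Qed.

Fact free_mulgV : right_inverse free_one free_inv free_mul.
Proof.
move=> g; rewrite -[g]free_classK free_invE free_mulE.
exact/free_classP/free_eq_catV.
Qed.

Fact free_mulVg : left_inverse free_one free_inv free_mul.
Proof.
move=> g; rewrite -[g]free_classK free_invE free_mulE.
rewrite -{2}[repr g]word_invK; exact/free_classP/free_eq_catV.
Qed.

HB.instance Definition _ :=
  isGroup.Build free_group free_mulA free_mul1 free_1mul free_mulVg free_mulgV.

Lemma free_class1 : free_class [::] = 1 :> free_group.
Proof. by []. Qed.

Lemma free_classM u v :
  free_class (u ++ v) = free_class u * free_class v :> free_group.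
Proof. by rewrite -free_mulE. Qed.

Lemma free_classV u : free_class (word_inv u) = (free_class u)^-1 :> free_group.
Proof. by rewrite -free_invE. Qed.

Definition free_gen (x : X) : free_group := free_class [:: (x, false)].

Section Lift.
Variables (H : groupType) (f : X -> H).

Definition letter_eval (l : X * bool) : H := if l.2 then (f l.1)^-1 else f l.1.
Definition word_eval (u : word) : H := \prod_(l <- u) letter_eval l.

Lemma word_eval_cat u v : word_eval (u ++ v) = word_eval u * word_eval v.
Proof. by rewrite /word_eval big_cat. Qed.

Lemma word_eval_free_eq u v : free_eq u v -> word_eval u = word_eval v.
Proof.
elim=> {u v} [a b x e|a|a b _|a b c _ ab _ bc] //; last by rewrite ab.
rewrite !word_eval_cat; congr (_ * _).
rewrite /word_eval !big_cons mulgA -[RHS]mul1g; congr (_ * _).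
by case: e; rewrite /letter_eval /= ?mulVg ?mulgV.
Qed.

Definition free_lift (g : free_group) : H := word_eval (repr g).

Lemma free_liftE u : free_lift (free_class u) = word_eval u.
Proof. by apply/word_eval_free_eq/free_classP; rewrite free_classK. Qed.

Fact free_liftM : {morph free_lift : g h / g * h}.
Proof. by move=> g h; rewrite {1}/mul /= free_liftE word_eval_cat. Qed.

HB.instance Definition _ := isUMagmaMorphism.Build free_group H free_lift
    (group_monoid_morphism free_liftM).

Lemma free_lift_gen x : free_lift (free_gen x) = f x.
Proof. by rewrite free_liftE /word_eval big_seq1. Qed.

End Lift.

Lemma free_lift_unique (H : groupType) (p q : {hom free_group -> H}) :
  (forall x, p (free_gen x) = q (free_gen x)) -> p =1 q.
Proof.
move=> pq g; rewrite -[g]free_classK; elim: (repr g) => [|[x b] u IHu].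
  by rewrite free_class1 !gmulf1.
rewrite -cat1s free_classM !gmulfM IHu; congr (_ * _).
case: b; last exact: pq.
by rewrite -[[:: _]]/(word_inv [:: (x, false)]) free_classV !gmulfV pq.
Qed.

End FreeGroup.

Section Quotient.
Variables (G : groupType) (R : set G).

Definition quo_eqb (x y : G) : bool := `[< normal_closure R (x / y) >].

Lemma generated_conj (A : set G) :
    (forall x y, A x -> A (x ^ y)) ->
  forall x y, generated A x -> generated A (x ^ y).
Proof.
move=> AJ x y; elim=> {x} [x Ax||u v _ IHu _ IHv|u _ IHu].
- exact/gen_in/AJ.
- rewrite conj1g; exact: gen_1.
- by rewrite conjMg; exact: gen_M.
- by rewrite conjVg; exact: gen_V.
Qed.

Lemma normal_closure_conj x y :
  normal_closure R x -> normal_closure R (x ^ y).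
Proof.
apply: generated_conj => {x y} _ y [r Rr [g _ <-]].
by exists r => //; exists (g * y) => //; rewrite conjgM.
Qed.

Fact quo_eqb_refl : reflexive quo_eqb.
Proof. by move=> x; apply/asboolP; rewrite mulgV; exact: gen_1. Qed.

Fact quo_eqb_sym : symmetric quo_eqb.
Proof.
by move=> x y; apply/asboolP/asboolP => /gen_V; rewrite invgF.
Qed.

Fact quo_eqb_trans : transitive quo_eqb.
Proof.
move=> y x z /asboolP xy /asboolP yz; apply/asboolP.
by have := gen_M xy yz; rewrite mulgA mulgVK.
Qed.

Canonical quo_eqb_equiv := EquivRel quo_eqb quo_eqb_refl quo_eqb_sym quo_eqb_trans.

Definition quo_group := {eq_quot quo_eqb}.
HB.instance Definition _ := EqQuotient.on quo_group.
HB.instance Definition _ := Choice.on quo_group.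

Definition quo_pi (x : G) : quo_group := \pi_quo_group x.

Lemma quo_piP x y : quo_pi x = quo_pi y <-> normal_closure R (x / y).
Proof. split=> [/eqmodP/asboolP //|xy]; apply/eqmodP; exact/asboolP. Qed.

Lemma quo_piK (a : quo_group) : quo_pi (repr a) = a.
Proof. exact: reprK. Qed.

Definition quo_mul (a b : quo_group) := quo_pi (repr a * repr b).
Definition quo_inv (a : quo_group) := quo_pi (repr a)^-1.

Lemma quo_mulE x y : quo_mul (quo_pi x) (quo_pi y) = quo_pi (x * y).
Proof.
have /quo_piP Nx := quo_piK (quo_pi x).
have /quo_piP Ny := quo_piK (quo_pi y).
set x' := repr _ in Nx *; set y' := repr _ in Ny *.
apply/quo_piP; have := gen_M (normal_closure_conj x'^-1 Ny) Nx.
by rewrite conjgE invgK invgM !mulgA mulgVK.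
Qed.

Lemma quo_invE x : quo_inv (quo_pi x) = quo_pi x^-1.
Proof.
have /quo_piP Nx := quo_piK (quo_pi x).
apply/quo_piP; have := normal_closure_conj x (gen_V Nx).
set x' := repr _ in Nx *.
by rewrite conjgE invgF invgK !mulgA mulVg mul1g.
Qed.

Fact quo_mulA : associative quo_mul.
Proof.
move=> a b c.
by rewrite -[a]quo_piK -[b]quo_piK -[c]quo_piK !quo_mulE mulgA.
Qed.

Fact quo_mul1 : left_id (quo_pi 1) quo_mul.
Proof. by move=> a; rewrite -[a]quo_piK quo_mulE mul1g. Qed.

Fact quo_1mul : right_id (quo_pi 1) quo_mul.
Proof. by move=> a; rewrite -[a]quo_piK quo_mulE mulg1. Qed.

Fact quo_mulVg : left_inverse (quo_pi 1) quo_inv quo_mul.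
Proof. by move=> a; rewrite -[a]quo_piK quo_invE quo_mulE mulVg. Qed.

Fact quo_mulgV : right_inverse (quo_pi 1) quo_inv quo_mul.
Proof. by move=> a; rewrite -[a]quo_piK quo_invE quo_mulE mulgV. Qed.

HB.instance Definition _ :=
  isGroup.Build quo_group quo_mulA quo_mul1 quo_1mul quo_mulVg quo_mulgV.

Fact quo_piM : {morph quo_pi : x y / x * y}.
Proof. by move=> x y; rewrite [RHS]quo_mulE. Qed.

HB.instance Definition _ := isUMagmaMorphism.Build G quo_group quo_pi
    (group_monoid_morphism quo_piM).

Section Lift.
Variables (H : groupType) (f : {hom G -> H}).
Hypothesis fR : forall r, R r -> f r = 1.

Lemma normal_closure_ker x : normal_closure R x -> f x = 1.
Proof.
elim=> {x} [_ [r Rr [g _ <-]]||u v _ IHu _ IHv|u _ IHu].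
- by rewrite gmulfJ (fR Rr) conj1g.
- exact: gmulf1.
- by rewrite gmulfM IHu IHv mulg1.
- by rewrite gmulfV IHu invg1.
Qed.

Definition quo_lift of (forall r, R r -> f r = 1) :=
  fun a : quo_group => f (repr a).

Lemma quo_liftE x : quo_lift fR (quo_pi x) = f x.
Proof.
have /quo_piP/normal_closure_ker := quo_piK (quo_pi x).
by rewrite gmulfF => /divg1_eq.
Qed.

Fact quo_liftM : {morph quo_lift fR : a b / a * b}.
Proof.
move=> a b; rewrite -[a]quo_piK -[b]quo_piK -gmulfM !quo_liftE; exact: gmulfM.
Qed.

End Lift.

HB.instance Definition _ (H : groupType) (f : {hom G -> H})
    (fR : forall r, R r -> f r = 1) :=
  isUMagmaMorphism.Build quo_group H (quo_lift fR)
    (group_monoid_morphism (quo_liftM fR)).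

End Quotient.

Record automorphism (G : groupType) := Automorphism {
  aut_fun :> G -> G;
  aut_inv : G -> G;
  autM : {morph aut_fun : x y / x * y};
  autK : cancel aut_fun aut_inv;
  autVK : cancel aut_inv aut_fun }.

HB.instance Definition _ (G : groupType) := gen_eqMixin (automorphism G).
HB.instance Definition _ (G : groupType) := gen_choiceMixin (automorphism G).

Section Automorphism.
Variable G : groupType.
Implicit Types f g h : automorphism G.

Lemma aut_eq f g : f =1 g -> f = g.
Proof.
case: f g => [f f' fM fK f'K] [g g' gM gK g'K] /= fg.
have efg : f = g by apply: funext.
subst g; have e' : f' = g' by apply: funext => x; rewrite -[f' x]gK f'K.
by subst g'; congr Automorphism; exact: Prop_irrelevance.
Qed.

Fact aut_invM f : {morph aut_inv f : x y / x * y}.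
Proof. by move=> x y; rewrite -{1}[x](autVK f) -{1}[y](autVK f) -autM autK. Qed.

(* Automorphisms act on the right: in [f * g], [f] is applied first. *)
Definition aut_mul f g : automorphism G :=
  @Automorphism G (g \o f) (aut_inv f \o aut_inv g)
    (fun x y => etrans (congr1 g (autM f x y)) (autM g _ _))
    (can_comp (autK g) (autK f)) (can_comp (autVK f) (autVK g)).

Definition aut_one : automorphism G :=
  @Automorphism G id id (fun x y => erefl) (fun x => erefl) (fun x => erefl).

Definition aut_V f : automorphism G :=
  Automorphism (aut_invM f) (autVK f) (autK f).

Fact aut_mulA : associative aut_mul. Proof. by move=> f g h; exact: aut_eq. Qed.
Fact aut_mul1 : left_id aut_one aut_mul. Proof. by move=> f; exact: aut_eq. Qed.
Fact aut_1mul : right_id aut_one aut_mul. Proof. by move=> f; exact: aut_eq. Qed.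
Fact aut_mulVg : left_inverse aut_one aut_V aut_mul.
Proof. by move=> f; apply: aut_eq => x; exact: autVK. Qed.
Fact aut_mulgV : right_inverse aut_one aut_V aut_mul.
Proof. by move=> f; apply: aut_eq => x; exact: autK. Qed.

HB.instance Definition _ := isGroup.Build (automorphism G)
  aut_mulA aut_mul1 aut_1mul aut_mulVg aut_mulgV.

HB.instance Definition _ f := isUMagmaMorphism.Build G G f
    (group_monoid_morphism (autM f)).

End Automorphism.

Inductive vb2_letter := Sigma1 | Rho1.
HB.instance Definition _ := gen_eqMixin vb2_letter.
HB.instance Definition _ := gen_choiceMixin vb2_letter.

Definition VB2_relators : set (free_group vb2_letter) :=
  [set free_gen Rho1 ^+ 2].

Definition VB2 : groupType := quo_group VB2_relators.

Definition sigma1 : VB2 := quo_pi VB2_relators (free_gen Sigma1).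
Definition rho1 : VB2 := quo_pi VB2_relators (free_gen Rho1).

Inductive F3_letter := X1 | X2 | Y.
HB.instance Definition _ := gen_eqMixin F3_letter.
HB.instance Definition _ := gen_choiceMixin F3_letter.

Definition F3 : groupType := free_group F3_letter.
Definition x1 : F3 := free_gen X1.
Definition x2 : F3 := free_gen X2.
Definition y : F3 := free_gen Y.

Definition sigma_fun (l : F3_letter) : F3 :=
  match l with X1 => x1 * x2 * x1^-1 | X2 => x1 | Y => y end.

Definition sigma_inv_fun (l : F3_letter) : F3 :=
  match l with X1 => x2 | X2 => x2^-1 * x1 * x2 | Y => y end.

Definition rho_fun (l : F3_letter) : F3 :=
  match l with X1 => x2 ^ y^-1 | X2 => x1 ^ y | Y => y end.

Lemma free_liftF3 (f : F3_letter -> F3) :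
  ((free_lift f x1 = f X1) * (free_lift f x2 = f X2) * (free_lift f y = f Y))%type.
Proof. by split; [split|]; exact: free_lift_gen. Qed.

Lemma free_lift_cancel (f g : F3_letter -> F3) :
  (forall l, free_lift g (f l) = free_gen l) ->
  cancel (free_lift f) (free_lift g).
Proof.
move=> fg u.
apply: (@free_lift_unique _ F3 (free_lift g \o free_lift f) idfun) => l /=.
by rewrite free_lift_gen fg.
Qed.

Fact sigma_funK : cancel (free_lift sigma_fun) (free_lift sigma_inv_fun).
Proof.
apply: free_lift_cancel; case=> /=;
  rewrite ?gmulfM ?gmulfV /= !free_liftF3 //=.
by rewrite !mulgA mulgV mul1g mulgK.
Qed.

Fact sigma_inv_funK : cancel (free_lift sigma_inv_fun) (free_lift sigma_fun).
Proof.
apply: free_lift_cancel; case=> /=;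
  rewrite ?gmulfM ?gmulfV /= !free_liftF3 //=.
by rewrite !mulgA mulVg mul1g mulgVK.
Qed.

Fact rho_funK : cancel (free_lift rho_fun) (free_lift rho_fun).
Proof.
apply: free_lift_cancel; case=> /=;
  rewrite ?gmulfJ ?gmulfV /= !free_liftF3 //=.
- exact: conjgK.
- exact: conjgKV.
Qed.

Definition phiA_sigma1 : automorphism F3 :=
  Automorphism (free_liftM sigma_fun) sigma_funK sigma_inv_funK.
Definition phiA_rho1 : automorphism F3 :=
  Automorphism (free_liftM rho_fun) rho_funK rho_funK.

Definition phiA_letter (l : vb2_letter) : automorphism F3 :=
  match l with Sigma1 => phiA_sigma1 | Rho1 => phiA_rho1 end.

Fact phiA_relators r : VB2_relators r -> free_lift phiA_letter r = 1.
Proof.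
move=> ->; rewrite gmulfXn /= free_lift_gen; apply: aut_eq => u /=.
exact: rho_funK.
Qed.

Definition phiA : {hom VB2 -> automorphism F3} :=
  quo_lift phiA_relators.

(* < x1, x2, y | x_i = phiA(b)(x_i), i = 1, 2 > *)
Definition GA_relators (b : VB2) : set F3 :=
  [set x / phiA b x | x in [set x1; x2]].

Definition GA (b : VB2) : groupType := quo_group (GA_relators b).

(* The virtual trefoil is the closure of this braid. *)
Definition virtual_trefoil_braid : VB2 := sigma1 ^- 2 * rho1.

Lemma phiA_sigma1E : phiA sigma1 = phiA_sigma1.
Proof. by rewrite [LHS]quo_liftE /= free_lift_gen. Qed.

Lemma phiA_rho1E : phiA rho1 = phiA_rho1.
Proof. by rewrite [LHS]quo_liftE /= free_lift_gen. Qed.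

Lemma phiA_trefoil u : phiA virtual_trefoil_braid u =
  free_lift rho_fun (free_lift sigma_inv_fun (free_lift sigma_inv_fun u)).
Proof. by rewrite gmulfM gmulfV gmulfXn phiA_sigma1E phiA_rho1E. Qed.

Lemma phiA_trefoil_x1 : phiA virtual_trefoil_braid x1 =
  y^-1 * x1^-1 * y ^+ 2 * x2 * y ^- 2 * x1 * y.
Proof.
rewrite phiA_trefoil.
do !rewrite ?gmulfM ?gmulfV /= !free_liftF3 /=.
by rewrite !(conjgE, expgS, expg0, mulg1, invgM, invgK, mulgA, mulgK).
Qed.

Lemma phiA_trefoil_x2 : phiA virtual_trefoil_braid x2 =
  y^-1 * x1^-1 * y ^+ 2 * x2^-1 * y ^- 2 * x1 * y
    * (y * x2 * y ^- 2 * x1 * y).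
Proof.
rewrite phiA_trefoil.
do !rewrite ?gmulfM ?gmulfV /= !free_liftF3 /=.
by rewrite !(conjgE, expgS, expg0, mulg1, invgM, invgK, mulgA, mulgK).
Qed.

(* Main.v *)
(* Write a = x1 and y_i = a^i y a^-i.  The relations of G(K_1) amount to
   x2 = a^-1 y^-1 a y a and y_3 = y_2^2 y_1^-1 y_0 y_1^-2 y_2, so G(K_1) is the
   semidirect product of the free group on p = y_0, q = y_0^-1 y_1 and
   r = q^-1 (a q a^-1) with the infinite cyclic group generated by t = a^-1,
   which acts by p -> p q, q -> q r and maps r to a conjugate of r.  Give p, q
   and r the weights 1, 2 and 3: then t acts trivially on the quotients of
   the weighted lower central series of the free group, whose terms therefore
   contain those of the lower central series of G(K_1) from the commutator
   subgroup on.  The weighted series has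
   trivial intersection: in the faithful Magnus representation an element f of
   its n-th term maps every series v to v plus terms of order at least n. *)
From HB Require Import structures.
From mathcomp Require Import all_boot all_algebra generic_quotient.
From mathcomp Require Import boolp classical_sets.
From mathcomp Require Import zify ring.
Require Import Defs.

Set Implicit Arguments.
Unset Strict Implicit.
Unset Printing Implicit Defensive.
Import Algebra GRing.Theory.
Local Open Scope classical_set_scope.
Local Open Scope group_scope.

(** Expands commutators and conjugates into left-associated words and reduces these freely, which
    proves identities valid in every group. *)
Ltac group_norm := do ?[rewrite !(commgEl, conjgE, invgM, invgK, mulgA, invg1, mulg1, mul1g)
    | rewrite !(mulgK, mulgVK, mulVg, mulgV)].

(** * Weighted lower central filtration of a free group *)

Lemma free_group_ind (X : choiceType) (P : free_group X -> Prop) :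
    P 1 -> (forall x, P (free_gen x)) ->
    (forall f g, P f -> P g -> P (f * g)) -> (forall f, P f -> P f^-1) ->
  forall f, P f.
Proof.
move=> P1 Pgen PM PV f; rewrite -[f]free_classK.
elim: (repr f) => [|[x b] u IHu]; first exact: P1.
rewrite -cat1s free_classM; apply: PM => //.
case: b; last exact: Pgen.
by rewrite -[[:: _]]/(word_inv [:: (x, false)]) free_classV; exact/PV/Pgen.
Qed.

Section Filtration.
Variables (X : choiceType) (wt : X -> nat).
Hypothesis wt_gt0 : forall x, (0 < wt x)%N.
Local Notation F := (free_group X).

(** The terms are built only from weighted generators, products, inverses and commutators. Normality
    is derived, and the inductive form allows induction on how an element enters a term. *)
Inductive weight_filt : nat -> set F :=
| filt_gen k x of (k <= wt x)%N : weight_filt k (free_gen x)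
| filt_1 k : weight_filt k 1
| filt_M k f g of weight_filt k f & weight_filt k g : weight_filt k (f * g)
| filt_V k f of weight_filt k f : weight_filt k f^-1
| filt_R i j k f g of (k <= i + j)%N & weight_filt i f & weight_filt j g :
    weight_filt k [~ f, g].

Lemma filt_all f : weight_filt 1 f.
Proof.
elim/free_group_ind: f => [|x|f g|f]; [exact: filt_1| | exact: filt_M | exact: filt_V].
exact: filt_gen.
Qed.

Lemma filt_anti i k f : (i <= k)%N -> weight_filt k f -> weight_filt i f.
Proof.
move=> + fk; elim: fk i => {k f} [k x kx|k|k f g _ IHf _ IHg|k f _ IHf|i j k f g kij fi _ gj _] l lk.
- exact: filt_gen (leq_trans lk kx).
- exact: filt_1.
- by apply: filt_M; [apply: IHf|apply: IHg].
- by apply: filt_V; apply: IHf.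
- exact: filt_R (leq_trans lk kij) fi gj.
Qed.

Lemma filt_commr k f g : weight_filt k f -> weight_filt k.+1 [~ f, g].
Proof. by move=> fk; apply: filt_R fk (filt_all g); rewrite addn1. Qed.

(** [f ^ g] is [f * [~ f, g]], and since all of [F] has weight 1 the commutator lies even one term
    deeper. *)
Lemma filt_conj k f g : weight_filt k f -> weight_filt k (f ^ g).
Proof.
move=> fk; rewrite -[f ^ g](mulVKg f) -commgEl; apply: filt_M => //.
exact: filt_anti (leqnSn k) (filt_commr g fk).
Qed.

Lemma filt_mul_cong k f f' g g' : weight_filt k (f^-1 * f') ->
  weight_filt k (g^-1 * g') -> weight_filt k ((f * g)^-1 * (f' * g')).
Proof.
move=> ff' gg'.
rewrite (_ : _ * _ = (f^-1 * f') ^ g * (g^-1 * g')); last first.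
  by group_norm.
by apply: filt_M gg'; exact: filt_conj.
Qed.

Lemma filt_inv_cong k f f' : weight_filt k (f^-1 * f') ->
  weight_filt k ((f^-1)^-1 * f'^-1).
Proof.
move=> /filt_V /(filt_conj f^-1).
by rewrite conjgE invgM !invgK !mulgA mulgK.
Qed.

(** To act trivially on every quotient of the filtration, it suffices to move each generator by a
    factor of larger weight: this propagates through products, inverses and commutators. *)
Lemma filt_endo (b : {hom F -> F}) k f :
    (forall x, weight_filt (wt x).+1 ((free_gen x)^-1 * b (free_gen x))) ->
  weight_filt k f -> weight_filt k.+1 (f^-1 * b f).
Proof.
move=> bgen; elim=> {k f} [k x kx|k|k f g _ IHf _ IHg|k f _ IHf|i j k f g kij fi IHf gj IHg].
- exact: filt_anti (bgen x).
- rewrite gmulf1 mulg1 invg1; exact: filt_1.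
- by rewrite gmulfM; exact: filt_mul_cong.
- by rewrite gmulfV; exact: filt_inv_cong.
(* Multiplying the second entry of a commutator by an element of weight [j'] changes the commutator
   only in weight [i' + j']. *)
have comm_cong i' j' a c d : (k < i' + j')%N -> weight_filt i' a -> weight_filt j' (c^-1 * d) ->
    weight_filt k.+1 ([~ a, c]^-1 * [~ a, d]).
  move=> lt_k ai cd.
  rewrite -(mulVKg c d); set e := _ * d in cd *.
  have -> : [~ a, c]^-1 * [~ a, c * e] = [~ a, c]^-1 * ([~ a, e] * [~ a, c] ^ e).
    by group_norm.
  have -> : [~ a, c]^-1 * ([~ a, e] * [~ a, c] ^ e)
      = [~ a, e] ^ [~ a, c] * [~ [~ a, c], e].
    by group_norm.
  apply: filt_M; first by apply/filt_conj/(filt_R _ ai cd).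
  apply: (filt_R _ (filt_R (leqnn _) ai (filt_all c)) cd); lia.
rewrite gmulfR /=.
have -> : [~ f, g]^-1 * [~ b f, b g] =
    ([~ f, g]^-1 * [~ f, b g]) * ([~ f, b g]^-1 * [~ b f, b g]).
  by rewrite -mulgA mulVKg.
apply: filt_M; first by apply: comm_cong fi IHg; lia.
(* Inverting swaps the two entries, so the change of the first entry is also covered by
   [comm_cong]. *)
rewrite -[X in X^-1 * _]invgR -[X in _^-1 * X]invgR.
apply: filt_inv_cong; apply: (comm_cong j i.+1) => //; first lia.
rewrite -[b g](mulVKg g); apply: filt_M => //.
exact: filt_anti IHg.
Qed.

End Filtration.

(** * Magnus representation and its faithfulness *)

Section MagnusModule.
Variable X : choiceType.
Local Notation F := (free_group X).
Local Notation V := (seq X -> int).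
Implicit Types (v : V) (f g : F) (w : seq X).

(* Left multiplication by [x] in the ring of noncommutative power series in
   [X] over the integers modulo the squares of the variables; a series is the
   function mapping a word to its coefficient. *)
Definition var_mul (x : X) v : V := fun w =>
  if w is z :: w' then
    if (z == x) && (ohead w' != Some x) then v w' else 0%R
  else 0%R.

Definition letter_sign (b : bool) : int := if b then (-1)%R else 1%R.

(** Since [x] squares to zero, [1 + e x] is [(1 + x)^e] for every integer [e]: a whole syllable acts
    in one step. *)
Definition magnus_syl (x : X) (e : int) v : V :=
  fun w => (v w + e * var_mul x v w)%R.

Definition magnus_word (u : word X) v : V :=
  foldr (fun l => magnus_syl l.1 (letter_sign l.2)) v u.

Definition magnus f v : V := magnus_word (repr f) v.

Lemma magnus_sylD x e e' v :
  magnus_syl x e (magnus_syl x e' v) = magnus_syl x (e + e')%R v.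
Proof.
apply: funext => -[|z w]; rewrite /magnus_syl /=; first by ring.
case: eqP => [->|] /=; last by move=> _; ring.
case: w => [|z' w] /=; first by ring.
case: eqP => [_|zx] /=; first by ring.
have -> : (z' == x) = false by apply/eqP => zx'; apply: zx; rewrite zx'.
by rewrite /=; ring.
Qed.

Lemma magnus_syl0 x v : magnus_syl x 0%R v = v.
Proof. by apply: funext => w; rewrite /magnus_syl mul0r addr0. Qed.

Lemma magnus_word_cat u u' v :
  magnus_word (u ++ u') v = magnus_word u (magnus_word u' v).
Proof. exact: foldr_cat. Qed.

Lemma magnusE u v : magnus (free_class u) v = magnus_word u v.
Proof.
suff eqP u1 u2 : free_eq u1 u2 -> magnus_word u1 =1 magnus_word u2.
  by apply: eqP; apply/free_classP; rewrite free_classK.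
elim=> {u u1 u2 v} [a b x e|a|a b _|a b c _ ab _ bc] v //; last by rewrite ab.
rewrite !magnus_word_cat /= magnus_sylD -[X in magnus_syl x X](_ : 0%R = _).
  by rewrite magnus_syl0.
by case: e.
Qed.

Lemma magnus1 v : magnus 1 v = v.
Proof. by rewrite -free_class1 magnusE. Qed.

Lemma magnusM f g v : magnus (f * g) v = magnus f (magnus g v).
Proof.
by rewrite -[f]free_classK -[g]free_classK -free_classM !magnusE magnus_word_cat.
Qed.

Lemma magnus_gen x v : magnus (free_gen x) v = magnus_syl x 1%R v.
Proof. exact: magnusE. Qed.

Definition gen_pow (x : X) (e : int) : F :=
  match e with Posz n => free_gen x ^+ n | Negz n => free_gen x ^- n.+1 end.

Lemma gen_powD1 x e : gen_pow x (1 + e)%R = free_gen x * gen_pow x e.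
Proof.
case: e => [n|[|n]] /=.
- by rewrite add1n expgS.
- by rewrite expg0 expg1 mulgV.
- by rewrite subn1 (expgSr _ n.+1) invgM mulVKg.
Qed.

Lemma gen_powB1 x e : gen_pow x (-1 + e)%R = (free_gen x)^-1 * gen_pow x e.
Proof. by rewrite -{2}[e](addNKr 1%R) gen_powD1 mulKg. Qed.

Lemma magnus_genV x v : magnus (free_gen x)^-1 v = magnus_syl x (-1)%R v.
Proof. by rewrite -free_classV magnusE. Qed.

Lemma magnus_gen_pow x e v : magnus (gen_pow x e) v = magnus_syl x e v.
Proof.
elim: e => [|n IHn|n IHn]; first by rewrite magnus1 magnus_syl0.
- rewrite (_ : Posz n.+1 = 1 + Posz n)%R ?gen_powD1; last lia.
  by rewrite magnusM IHn magnus_gen magnus_sylD.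
- rewrite (_ : - n.+1%:Z = -1 + - n%:Z)%R; last by lia.
  by rewrite gen_powB1 magnusM IHn magnus_genV magnus_sylD.
Qed.

Definition syl_prod (s : seq (X * int)) : F := \prod_(l <- s) gen_pow l.1 l.2.

Definition reduced (s : seq (X * int)) : bool :=
  all (fun l => l.2 != 0%R) s && sorted (fun l l' => l.1 != l'.1) s.

(** A new letter either opens a syllable or merges with the first one, which disappears if the
    exponents cancel. *)
Lemma reducedP f : exists2 s, reduced s & f = syl_prod s.
Proof.
rewrite -[f]free_classK; elim: (repr f) => [|[x b] u [s sr fs]].
  by exists [::] => //; rewrite /syl_prod big_nil.
have -> : free_class ((x, b) :: u) = gen_pow x (letter_sign b) * syl_prod s.
  rewrite -cat1s free_classM fs; congr (_ * _).
  by case: b; rewrite //= expg1 -free_classV.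
have genpow e : gen_pow x (letter_sign b) * gen_pow x e
    = gen_pow x (letter_sign b + e)%R.
  case: b; first by rewrite gen_powB1 /= expg1.
  by rewrite gen_powD1 /= expg1.
have cons_prod l s' : syl_prod (l :: s') = gen_pow l.1 l.2 * syl_prod s'.
  exact: big_cons.
have b0 : letter_sign b != 0%R by case: (b).
case: s sr {fs} => [|[z e] s] sr.
  by exists [:: (x, letter_sign b)]; [rewrite /reduced /= b0 | rewrite cons_prod].
case: (eqVneq x z) => [xz|xz]; last first.
  exists [:: (x, letter_sign b), (z, e) & s]; last by rewrite [RHS]cons_prod.
  by move: sr; rewrite /reduced /= b0 xz.
subst z; rewrite cons_prod mulgA genpow.
move: sr; rewrite /reduced /= => /andP[/andP[_ s0]] sP.
case: (eqVneq (letter_sign b + e)%R 0%R) => [->|be0].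
  by exists s; rewrite ?mul1g // s0 (path_sorted sP).
exists ((x, letter_sign b + e)%R :: s); last by rewrite [RHS]cons_prod.
by rewrite /= be0 s0 /=; case: (s) sP.
Qed.

Definition unit_series : V := fun w => (w == [::])%:R%R.

(** Each syllable raises the degree by at most one. *)
Lemma magnus_syl_prod s w : (size s < size w)%N ->
  magnus (syl_prod s) unit_series w = 0%R.
Proof.
elim: s w => [|l s IHs] w sw.
  by rewrite /syl_prod big_nil magnus1 /unit_series; case: w sw.
rewrite /syl_prod big_cons magnusM magnus_gen_pow /magnus_syl IHs ?(ltnW sw) //.
case: w sw => [//|z w] /= sw; case: ifP => _; last by rewrite mulr0.
by rewrite IHs ?mulr0.
Qed.

(** In top degree every syllable [1 + e x] must contribute [e x]; no square arises because
    neighbouring letters differ. *)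
Lemma magnus_syl_prod_lead s : reduced s ->
  magnus (syl_prod s) unit_series (map fst s) = (\prod_(l <- s) l.2)%R.
Proof.
elim: s => [|[x e] s IHs]; first by rewrite /syl_prod !big_nil magnus1.
rewrite /reduced /= => /andP[/andP[_ s0]] sP.
rewrite /syl_prod !big_cons magnusM magnus_gen_pow /magnus_syl.
rewrite magnus_syl_prod /= ?size_map // eqxx /= add0r IHs /reduced ?s0 ?(path_sorted sP) //.
case: s sP {IHs s0} => [|l s] //= /andP[xl _].
by case: eqP => // -[] lx; rewrite lx eqxx in xl.
Qed.

(** A nonempty reduced form has a nonzero leading coefficient, at a nonempty word where
    [unit_series] vanishes. *)
Lemma magnus_faithful f : magnus f unit_series = unit_series -> f = 1.
Proof.
have [s sr ->] := reducedP f => fix_unit.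
have := magnus_syl_prod_lead sr; rewrite fix_unit.
case: s sr {fix_unit} => [|l s]; first by move=> *; rewrite /syl_prod big_nil.
move=> /andP[s0 _] /esym/eqP; rewrite prodf_seq_eq0 => /hasP[k ks].
by rewrite /= (negbTE (allP s0 k ks)).
Qed.

End MagnusModule.

(** * Weighted order of series and triviality of the intersection of the filtration *)

Section MagnusWeight.
Variables (X : choiceType) (wt : X -> nat).
Local Notation F := (free_group X).
Local Notation V := (seq X -> int).
Implicit Types (v : V) (f g : F) (w : seq X).

Definition order_ge d v :=
  forall w, (\sum_(x <- w) wt x < d)%N -> v w = 0%R.

Definition magnus_diff f v : V := fun w => (magnus f v w - v w)%R.

Lemma magnus_diff1 v w : magnus_diff 1 v w = 0%R.
Proof. by rewrite /magnus_diff magnus1 subrr. Qed.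

Lemma magnusB f v v' :
  magnus f (fun w => v w - v' w)%R = (fun w => magnus f v w - magnus f v' w)%R.
Proof.
rewrite /magnus; elim: (repr f) => [|l u /= ->] //.
apply: funext => -[|z w]; rewrite /magnus_syl /=; first by ring.
by case: ifP => _; ring.
Qed.

Lemma order_ge_magnus d f v : order_ge d v -> order_ge d (magnus f v).
Proof.
move=> vd; rewrite /magnus; elim: (repr f) => [|l u IHu] //= w wd.
rewrite /magnus_syl IHu // add0r; case: w wd => [|z w] /= wd; first by rewrite mulr0.
rewrite IHu ?if_same ?mulr0 //; move: wd; rewrite big_cons; lia.
Qed.

(** An element of weight [k] acts as the identity plus an operator raising the order by [k]; for
    products, [fg - 1 = (f - 1)g + (g - 1)]. *)
Lemma magnus_diff_filt k f d v :
  weight_filt wt k f -> order_ge d v -> order_ge (d + k) (magnus_diff f v).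
Proof.
move=> fk; elim: fk d v => {k f} [k x kx|k|k f g _ IHf _ IHg|k f _ IHf|i j k f g kij fi IHf gj IHg] d v vd w wd.
- rewrite /magnus_diff magnus_gen /magnus_syl mul1r addrC addKr.
  case: w wd => [//|z w] /=; rewrite big_cons => wd; case: eqP => [zx|//] /=.
  by rewrite vd ?if_same //; subst z; lia.
- exact: magnus_diff1.
- rewrite -(addr0 0%R) -[X in (X + _)%R](IHf _ _ (order_ge_magnus g vd) _ wd).
  by rewrite -[X in (_ + X)%R](IHg _ _ vd _ wd) /magnus_diff magnusM; ring.
(* For inverses, [f^-1 - 1 = -(f - 1) f^-1]. *)
- have := IHf _ _ (order_ge_magnus f^-1 vd) _ wd.
  rewrite /magnus_diff -magnusM mulgV magnus1 => h.
  by rewrite -[LHS]opprK opprB h oppr0.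
(* [[~ f, g] - 1 = (g f)^-1 ((f - 1)(g - 1) - (g - 1)(f - 1))], where both products raise the order
   by [i + j]. *)
have -> : magnus_diff [~ f, g] v =
    magnus (g * f)^-1 (fun w => magnus_diff f (magnus_diff g v) w
                               - magnus_diff g (magnus_diff f v) w)%R.
  rewrite (_ : (fun w => _) = fun w => magnus (f * g)%g v w - magnus (g * f)%g v w)%R.
    rewrite magnusB -!magnusM mulVg magnus1; apply: funext => w'.
    by rewrite /magnus_diff; group_norm.
  apply: funext => w'; rewrite /magnus_diff !magnusB !magnusM; ring.
apply: order_ge_magnus wd => w' wd'.
rewrite (IHf _ _ (IHg _ _ vd)) ?(IHg _ _ (IHf _ _ vd)) ?subrr //; lia.
Qed.

Lemma filt_residual f : (forall n, weight_filt wt n f) -> f = 1.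
Proof.
move=> ff; apply: magnus_faithful; apply: funext => w.
apply/eqP; rewrite -subr_eq0; apply/eqP.
(* The index exceeds the weight of [w], so the coefficient at [w] is unchanged; order at least 0
   holds for every series. *)
apply: (@magnus_diff_filt (\sum_(x <- w) wt x).+1 f 0) => //.
Qed.

End MagnusWeight.

(** * Lower central series and nilpotent quotients *)

Section LowerCentral.
Variable G : groupType.
Implicit Types (A : set G) (x y : G).

Lemma normal_closure_id A : A 1 -> (forall x y, A x -> A y -> A (x * y)) ->
    (forall x, A x -> A x^-1) -> (forall x y, A x -> A (x ^ y)) ->
  normal_closure A = A.
Proof.
move=> A1 AM AV AJ; apply/seteqP; split=> x; last first.
  by move=> Ax; apply: gen_in; exists x => //; exists 1 => //; rewrite conjg1.
elim=> {x} [_ [r Ar [g _ <-]]||x y _ Ax _ Ay|x _ Ax].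
- exact: AJ.
- exact: A1.
- exact: AM.
- exact: AV.
Qed.

Lemma lower_central_conj n x y :
  lower_central G n x -> lower_central G n (x ^ y).
Proof.
elim: n x y => [|n IHn] x y //=; apply: generated_conj => {}x {}y.
move=> [u un [v _ <-]]; exists (u ^ y); first exact: IHn.
by exists (v ^ y) => //; rewrite conjRg.
Qed.

Lemma lower_central_normal_closure n :
  normal_closure (lower_central G n) = lower_central G n.
Proof.
apply: normal_closure_id; last exact: lower_central_conj.
all: case: n => [|n] //=.
- exact: gen_1.
- by move=> x y; exact: gen_M.
- by move=> x; exact: gen_V.
Qed.

Lemma lower_central_hom (H : groupType) (f : {hom G -> H}) n :
  (forall h, exists g, f g = h) ->
  forall h, lower_central H n h -> exists2 g, lower_central G n g & f g = h.
Proof.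
move=> f_surj; elim: n => [|n IHn] h; first by have [g] := f_surj h; exists g.
elim=> {h} [_ [u /IHn[x xn <-] [v _ <-]]||u v _ [x xn <-] _ [y yn <-]|u _ [x xn <-]].
- have [y <-] := f_surj v; exists [~ x, y]; last exact: gmulfR.
  by apply: gen_in; exists x => //; exists y.
- by exists 1; [exact: gen_1 | exact: gmulf1].
- by exists (x * y); [exact: gen_M | exact: gmulfM].
- by exists x^-1; [exact: gen_V | exact: gmulfV].
Qed.

Lemma nilpotent_quo_lower_central n :
  nilpotent_group (quo_group (lower_central G n)).
Proof.
exists n; apply/seteqP; split=> [a|_ ->]; last first.
  by case: n => [|n] //=; exact: gen_1.
have pi_surj (h : quo_group (lower_central G n)) :
    exists g, quo_pi (lower_central G n) g = h.
  by exists (repr h); exact: quo_piK.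
move=> /(lower_central_hom pi_surj)[g gn <-].
apply/quo_piP; rewrite divg1; rewrite lower_central_normal_closure.
exact: gn.
Qed.

End LowerCentral.

(** The separating maps are the composites of [f] with the projections of [S] onto its quotients by
    lower central terms. *)
Lemma residually_nilpotent_embed (G S : groupType) (f : {hom G -> S}) :
    (exists g : G, g <> 1) -> (forall g, f g = 1 -> g = 1) ->
    (forall s, (forall n, lower_central S n s) -> s = 1) ->
  residually_nilpotent G.
Proof.
move=> Gnt f_inj S_lc; split=> // g g1.
have [n gn] : exists n, ~ lower_central S n (f g).
  by apply: contra_notP g1 => /forallNP gn; apply/f_inj/S_lc => n; exact: contrapT (gn n).
exists (quo_group (lower_central S n)).
exists (quo_pi (lower_central S n) \o f); split.
  exact: nilpotent_quo_lower_central.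
move=> /= /quo_piP; rewrite divg1 lower_central_normal_closure; exact: gn.
Qed.

(** * Semidirect products and their lower central series *)

Lemma autV (G : groupType) (a : automorphism G) x : a x^-1 = (a x)^-1.
Proof. exact: (gmulfV a). Qed.

(* The pair (h, f) stands for the product h f, and f ^ h is [theta h f]. *)
Definition sdprod (H F : groupType) of {hom H -> automorphism F} : Type :=
  (H * F)%type.

Section SemidirectProduct.
Variables (H F : groupType) (theta : {hom H -> automorphism F}).

Local Notation sdp := (sdprod theta).
HB.instance Definition _ := Choice.on sdp.
Implicit Types (s u : sdp) (h : H) (f : F).

Definition sd_mul s u : sdp := (s.1 * u.1, theta u.1 s.2 * u.2).
Definition sd_one : sdp := (1, 1).
Definition sd_inv s : sdp := (s.1^-1, (theta s.1^-1 s.2)^-1).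

Lemma thetaM h h' f : theta (h * h') f = theta h' (theta h f).
Proof. by rewrite gmulfM. Qed.

Lemma theta1 f : theta 1 f = f.
Proof. by rewrite gmulf1. Qed.

Fact sd_mulA : associative sd_mul.
Proof.
by move=> [h f] [h' f'] [h2 f2]; rewrite /sd_mul /= !mulgA autM thetaM.
Qed.

Fact sd_mul1 : left_id sd_one sd_mul.
Proof. by move=> [h f]; rewrite /sd_mul /= gmulf1 !mul1g. Qed.

Fact sd_1mul : right_id sd_one sd_mul.
Proof. by move=> [h f]; rewrite /sd_mul /= theta1 !mulg1. Qed.

Fact sd_mulVg : left_inverse sd_one sd_inv sd_mul.
Proof.
move=> [h f]; rewrite /sd_mul /sd_inv /=.
by rewrite autV -thetaM !mulVg theta1 mulVg.
Qed.

Fact sd_mulgV : right_inverse sd_one sd_inv sd_mul.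
Proof. by move=> [h f]; rewrite /sd_mul /sd_inv /= !mulgV. Qed.

HB.instance Definition _ :=
  isGroup.Build sdp sd_mulA sd_mul1 sd_1mul sd_mulVg sd_mulgV.

Lemma sd_mulE s u : s * u = (s.1 * u.1, theta u.1 s.2 * u.2) :> sdp.
Proof. by []. Qed.

Lemma sd_invE s : s^-1 = (s.1^-1, (theta s.1^-1 s.2)^-1) :> sdp.
Proof. by []. Qed.

Lemma sd_conjE s u : s.1 = 1 -> s ^ u = (1, theta u.1 s.2 ^ u.2) :> sdp.
Proof.
move=> s1; rewrite conjgE !sd_mulE sd_invE /= s1 mul1g mulVg; congr (_, _).
by rewrite autV -thetaM mulVg theta1 conjgE.
Qed.

Section Lift.
Variables (K : groupType) (tau : {hom H -> K}) (iota : {hom F -> K}).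
Hypothesis iotaJ : forall h f, iota (theta h f) = iota f ^ tau h.

Definition sd_lift of (forall h f, iota (theta h f) = iota f ^ tau h) :=
  fun s : sdp => tau s.1 * iota s.2.

Fact sd_liftM : {morph sd_lift iotaJ : s u / s * u}.
Proof.
by move=> s u; rewrite /sd_lift /= !gmulfM iotaJ conjgE !mulgA mulgK.
Qed.

End Lift.

HB.instance Definition _ (K : groupType) (tau : {hom H -> K})
    (iota : {hom F -> K}) (iotaJ : forall h f, iota (theta h f) = iota f ^ tau h) :=
  isUMagmaMorphism.Build sdp K (@sd_lift K tau iota iotaJ)
    (group_monoid_morphism (sd_liftM iotaJ)).

(** The first commutator only kills the abelian factor [H]. Each later one gains a weight, since for
    [f] in [F] one has [[f, h f'] = (f^-1 f^h) [f^h, f']] and both factors lie one term deeper. *)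
Lemma lower_central_sdprod (fil : nat -> set F) :
    (forall h h', commute h h') ->
    (forall f, fil 1%N f) -> (forall n, fil n 1) ->
    (forall n f f', fil n f -> fil n f' -> fil n (f * f')) ->
    (forall n f, fil n f -> fil n f^-1) ->
    (forall n f f', fil n f -> fil n.+1 [~ f, f']) ->
    (forall n h f, fil n f -> fil n (theta h f) /\ fil n.+1 (f^-1 * theta h f)) ->
  forall n s, lower_central sdp n.+1 s -> s.1 = 1 /\ fil n.+1 s.2.
Proof.
move=> Hab fil1 fil_1 filM filV filR fil_theta.
have sub_fil n (A : set sdp) : (forall s, A s -> s.1 = 1 /\ fil n s.2) ->
    forall s, generated A s -> s.1 = 1 /\ fil n s.2.
  move=> An s; elim=> {s} [s /An //||s u _ [s1 sn] _ [u1 un]|s _ [s1 sn]] /=.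
  - by split=> //; exact: fil_1.
  - by rewrite s1 u1 mulg1 theta1; split=> //; exact: filM.
  - by rewrite s1 invg1 theta1; split=> //; exact: filV.
elim=> [|n IHn] s; apply: sub_fil => {}s [u un [v _ <-]].
  split; last exact: fil1.
  by rewrite commgEl conjgE /= (Hab u.1 v.1) !mulgA mulgVK mulVg.
have [u1 un'] := IHn u un.
rewrite commgEl (sd_conjE v u1) sd_mulE sd_invE /= u1 invg1 mulg1 !theta1.
split=> //; have [tn tun] := fil_theta _ v.1 _ un'.
have -> : u.2^-1 * theta v.1 u.2 ^ v.2
    = u.2^-1 * theta v.1 u.2 * [~ theta v.1 u.2, v.2].
  by rewrite commgEl -mulgA mulVKg.
by apply: filM => //; exact: filR.
Qed.

End SemidirectProduct.

Lemma free_gen_neq1 (X : choiceType) (x : X) : free_gen x <> 1.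
Proof.
move=> x1; have := magnus_gen x (@unit_series X).
rewrite x1 magnus1 => /(congr1 (@^~ [:: x])).
by rewrite /magnus_syl /= eqxx.
Qed.

Lemma inf_cyclic_commute (h h' : free_group unit) : commute h h'.
Proof.
have comm1 (g : free_group unit) : commute (free_gen tt) g.
  elim/free_group_ind: g => [|[]|f g|f]; [exact: commute1 | by [] | exact: commuteM | exact: commuteV].
elim/free_group_ind: h => [|[]|f g ff gg|f ff]; last 2 first.
- exact/commute_sym/commuteM; exact: commute_sym.
- exact/commute_sym/commuteV/commute_sym.
- exact/commute_sym/commute1.
- exact: comm1.
Qed.

(** * Relations of $G(K_1)$ and the shift automorphism *)

Section TrefoilRelations.
Variables (G : groupType) (a y : G).

Definition shift_q := y^-1 * y ^ a^-1.
Definition shift_r := shift_q^-1 * shift_q ^ a^-1.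
Definition shift_conj := shift_q^-1 * shift_q^-1 * y^-1 * shift_q * shift_r.
(** Writing [u] for this element, the relations are [a = u^-1 b u] and
    [b = (u^-1 b u)^-1 (y b u)]. *)
Definition trefoil_u := y^-1 * y^-1 * a * y.
Definition trefoil_x2 := a^-1 * y^-1 * a * y * a.

(** Both equations unfold to [y_3 = y_2^2 y_1^-1 y_0 y_1^-2 y_2]. *)
Lemma trefoil_relation_shift :
  shift_r ^ a^-1 = shift_r ^ shift_conj <->
  trefoil_x2 = trefoil_u * a * trefoil_u^-1.
Proof.
(* The conjugates are made abstract, so that [group_norm] treats them as letters. *)
have [y1 y1E] := ex_intro (fun z => y ^ a^-1 = z) _ erefl.
have [y2 y2E] := ex_intro (fun z => y1 ^ a^-1 = z) _ erefl.
have [y3 y3E] := ex_intro (fun z => y2 ^ a^-1 = z) _ erefl.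
have qE : shift_q = y^-1 * y1 by rewrite /shift_q y1E.
have rE : shift_r = y1^-1 * y * y1^-1 * y2.
  by rewrite /shift_r qE conjMg conjVg y1E y2E invgM invgK !mulgA.
have raE : shift_r ^ a^-1 = y2^-1 * y1 * y2^-1 * y3.
  by rewrite rE !conjMg !conjVg y1E y2E y3E.
have rcE : shift_r ^ shift_conj = y2^-1 * y1 * y2 * y1^-1 * y * y1^-1 * y1^-1 * y2.
  by rewrite /shift_conj rE qE; group_norm.
have x2E : trefoil_x2 ^ a^-1 = y^-1 * y1 * a.
  by rewrite /trefoil_x2 -y1E; group_norm.
have uE : (trefoil_u * a * trefoil_u^-1) ^ a^-1 =
    y1^-1 * y1^-1 * y2 * y3^-1 * y2 * y2 * a.
  by rewrite /trefoil_u -y3E -y2E -y1E; group_norm.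
rewrite raE rcE.
(* Conjugation by [a^-1] writes the second relator in the [y_i]; the other factor of the conjugator
   aligns it with the first. *)
have E : (y2^-1 * y1 * y2^-1 * y3) / (y2^-1 * y1 * y2 * y1^-1 * y * y1^-1 * y1^-1 * y2)
    = (trefoil_x2 / (trefoil_u * a * trefoil_u^-1)) ^
      (a^-1 * (y1^-1 * y1^-1 * y2 * y3^-1 * y2 * y1^-1 * y2)).
  by rewrite conjgM [(_ / _) ^ a^-1]conjMg conjVg x2E uE; group_norm.
split=> [e|e]; apply: divg1_eq; last by rewrite E e mulgV conj1g.
by move: E; rewrite e mulgV => /esym/eqP; rewrite conjg_eq1 => /eqP.
Qed.

(* The left-hand side is the presentation of G(K_1), with [x1 = a], [x2 = b]. *)
Lemma trefoil_relations_elim b :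
  a = y^-1 * a^-1 * y ^+ 2 * b * y ^- 2 * a * y /\
  b = y^-1 * a^-1 * y ^+ 2 * b^-1 * y ^- 2 * a * y
        * (y * b * y ^- 2 * a * y) <->
  b = trefoil_x2 /\ shift_r ^ a^-1 = shift_r ^ shift_conj.
Proof.
rewrite trefoil_relation_shift; have [u uE] := ex_intro (eq trefoil_u) _ erefl.
rewrite uE; rewrite /trefoil_u in uE.
have uV : u^-1 = y^-1 * a^-1 * y ^+ 2 by rewrite -uE expg2; group_norm.
have -> : y^-1 * a^-1 * y ^+ 2 * b * y ^- 2 * a * y = u^-1 * b * u.
  by rewrite uV -uE expg2; group_norm.
have -> : y^-1 * a^-1 * y ^+ 2 * b^-1 * y ^- 2 * a * y * (y * b * y ^- 2 * a * y)
    = (u^-1 * b * u)^-1 * (y * b * u).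
  by rewrite uV -uE expg2; group_norm.
split=> [[e1 e2]|[-> e]].
  have b_u : b = u * a * u^-1 by rewrite e1; group_norm.
  (* By the first relation the second is [b = a^-1 y b u]; substituting [b = u a u^-1] leaves
     [a^-1 y u a], which is [trefoil_x2]. *)
  suff bE : b = trefoil_x2 by rewrite -bE.
  by rewrite [LHS]e2 -e1 b_u /trefoil_x2 -uE; group_norm.
have e1 : a = u^-1 * trefoil_x2 * u by rewrite e; group_norm.
by split=> //; rewrite -e1 [in RHS]e /trefoil_x2 -uE; group_norm.
Qed.

End TrefoilRelations.

Lemma gmulf_trefoil_x2 (G H : groupType) (f : {hom G -> H}) a y :
  f (trefoil_x2 a y) = trefoil_x2 (f a) (f y).
Proof. by rewrite !(gmulfM, gmulfV). Qed.

(* Below, the free group on p, q, r is again [F3], with p = x1, q = x2, r = y. *)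
Definition shift_fun (l : F3_letter) : F3 :=
  match l with
  | X1 => x1 * x2
  | X2 => x2 * y
  | Y => y ^ (x2^-1 * x2^-1 * x1^-1 * x2 * y)
  end.

(** [y'] is the preimage of [r]; those of [q] and [p] then follow from [q -> q r] and [p -> p q]. *)
Definition shift_inv_fun (l : F3_letter) : F3 :=
  let y' := y ^ (x2^-1 * x1 * x2) in
  match l with X1 => x1 * (y' * x2^-1) | X2 => x2 * y'^-1 | Y => y' end.

Fact shift_funK : cancel (free_lift shift_fun) (free_lift shift_inv_fun).
Proof.
by apply: free_lift_cancel; case=> /=;
  rewrite ?(gmulfJ, gmulfM, gmulfV) /= !free_liftF3 /=; group_norm.
Qed.

Fact shift_inv_funK : cancel (free_lift shift_inv_fun) (free_lift shift_fun).
Proof.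
by apply: free_lift_cancel; case=> /=;
  rewrite ?(gmulfJ, gmulfM, gmulfV) /= !free_liftF3 /=; group_norm.
Qed.

Definition shift : automorphism F3 :=
  Automorphism (free_liftM shift_fun) shift_funK shift_inv_funK.

(** * Effect of the shift on weights, and residual triviality for the semidirect product *)

Definition shift_wt (l : F3_letter) : nat :=
  match l with X1 => 1 | X2 => 2 | Y => 3 end.

Local Notation fil := (weight_filt shift_wt).

Lemma shift_wt_gt0 l : (0 < shift_wt l)%N. Proof. by case: l. Qed.

(** [p] and [q] change by [q] and [r], of the next weight, and [r] by a commutator with [r]. *)
Lemma filt_shift n f : fil n f -> fil n.+1 (f^-1 * shift f).
Proof.
apply: (filt_endo shift_wt_gt0 (b := free_lift shift_fun)) => -[] /=;
  rewrite free_lift_gen /= ?mulKg.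
- exact: filt_gen.
- exact: filt_gen.
- by rewrite -commgEl; apply: filt_commr; [exact: shift_wt_gt0 | exact: filt_gen].
Qed.

Lemma filt_shiftV n f : fil n f -> fil n.+1 (f^-1 * shift^-1 f).
Proof.
have fy g : fil 3 (y ^ g).
  by apply: filt_conj; [exact: shift_wt_gt0 | exact: filt_gen].
apply: (filt_endo shift_wt_gt0 (b := free_lift shift_inv_fun)) => -[] /=;
  rewrite free_lift_gen /= ?mulKg.
- apply: (filt_M (f := y ^ _) (g := x2^-1)); first exact: (filt_anti _ (fy _)).
  by apply: filt_V; exact: filt_gen.
- exact: filt_V.
- by rewrite -commgEl; apply: filt_commr; [exact: shift_wt_gt0 | exact: filt_gen].
Qed.

Local Notation Z := (free_group unit).
Definition shift_act : {hom Z -> automorphism F3} := free_lift (fun _ => shift).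

Lemma shift_act_gen : shift_act (free_gen tt) = shift.
Proof. exact: free_lift_gen. Qed.

Lemma filt_shift_act n h f :
  fil n f -> fil n (shift_act h f) /\ fil n.+1 (f^-1 * shift_act h f).
Proof.
move=> fn; suff hn : fil n.+1 (f^-1 * shift_act h f).
  split=> //; rewrite -(mulVKg f (shift_act h f)); apply: filt_M => //.
  exact: filt_anti hn.
pose P h := forall n f, fil n f -> fil n.+1 (f^-1 * shift_act h f).
(* Carrying [h] and [h^-1] together makes the inverse case of the induction immediate. *)
suff: P h /\ P h^-1 by move=> [hP _]; exact: hP.
have PM h1 h2 : P h1 -> P h2 -> P (h1 * h2).
  move=> P1 P2 {fn} k g gk; rewrite thetaM.
  rewrite -(mulVKg (shift_act h1 g) (shift_act h2 _)) mulgA.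
  apply: filt_M (P1 _ _ gk) (P2 _ _ _); rewrite -(mulVKg g (shift_act h1 g)).
  apply: filt_M => //; exact: filt_anti (P1 _ _ gk).
elim/free_group_ind: h => [|[]|h1 h2 [P1 P1'] [P2 P2']|h1 [P1 P1']].
- by rewrite invg1; split=> k g _; rewrite theta1 mulVg; exact: filt_1.
- split=> k g; first by rewrite shift_act_gen; exact: filt_shift.
  by rewrite gmulfV shift_act_gen; exact: filt_shiftV.
- by rewrite invgM; split; exact: PM.
- by rewrite invgK.
Qed.

Local Notation S := (sdprod shift_act).

Lemma lower_central_residual (s : S) : (forall n, lower_central S n s) -> s = 1.
Proof.
move=> sn; have s_fil n : s.1 = 1 /\ fil n.+1 s.2.
  apply: (lower_central_sdprod (fil := fil)) (sn n.+1).
  - exact: inf_cyclic_commute.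
  - exact: filt_all shift_wt_gt0.
  - exact: filt_1.
  - exact: filt_M.
  - exact: filt_V.
  - exact: (filt_commr shift_wt_gt0).
  - exact: filt_shift_act.
rewrite [LHS]surjective_pairing (s_fil 0%N).1 (_ : s.2 = 1) //.
apply: (@filt_residual _ shift_wt) => n.
exact: filt_anti (leqnSn n) (s_fil n).2.
Qed.

(** * Embedding of $G(K_1)$ into the semidirect product *)

Definition sd_t : S := (free_gen tt, 1).
Definition sd_a : S := sd_t^-1.
Definition sd_F (f : F3) : S := (1, f).

Lemma sd_FM : {morph sd_F : f g / f * g}.
Proof. by move=> f g; rewrite sd_mulE /= mulg1 theta1. Qed.

HB.instance Definition _ :=
  isUMagmaMorphism.Build F3 S sd_F (group_monoid_morphism sd_FM).

Lemma sd_F_shift f : sd_F (shift f) = sd_F f ^ sd_a^-1.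
Proof.
have -> : sd_F (shift f) = (1, shift_act (free_gen tt) f ^ 1).
  by rewrite shift_act_gen conjg1.
by rewrite /sd_a invgK sd_conjE.
Qed.

(** The constructors are the generators of the presentation, whereas [sd_F x1] is [p]; the image of
    [X2] is forced by the relations. *)
Definition sd_gen (l : F3_letter) : S :=
  match l with
  | X1 => sd_a
  | X2 => trefoil_x2 sd_a (sd_F x1)
  | Y => sd_F x1
  end.

Lemma sd_shift_q : shift_q sd_a (sd_F x1) = sd_F x2.
Proof.
by rewrite /shift_q -sd_F_shift -gmulfV -gmulfM /= free_lift_gen mulKg.
Qed.

Lemma sd_shift_r : shift_r sd_a (sd_F x1) = sd_F y.
Proof.
by rewrite /shift_r sd_shift_q -sd_F_shift -gmulfV -gmulfM /= free_lift_gen mulKg.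
Qed.

Section ToSemidirect.
Local Notation b := virtual_trefoil_braid.

Lemma GA_relatorsP (K : groupType) (f : {hom F3 -> K}) :
  (forall r, GA_relators b r -> f r = 1) <->
  f x1 = f (phiA b x1) /\ f x2 = f (phiA b x2).
Proof.
split=> [fr|[f1 f2] _ [x [->|->] <-]].
- by split; apply: divg1_eq; rewrite -gmulfF; apply: fr;
    [exists x1; first left | exists x2; first right].
- by rewrite gmulfF -f1 mulgV.
- by rewrite gmulfF -f2 mulgV.
Qed.

(** Read from right to left it yields the map into [S]; from left to right, the relations holding in
    [GA b]. *)
Lemma trefoil_relatorsP (K : groupType) (f : {hom F3 -> K}) :
  (forall r, GA_relators b r -> f r = 1) <->
  f x2 = trefoil_x2 (f x1) (f y) /\
  shift_r (f x1) (f y) ^ (f x1)^-1 = shift_r (f x1) (f y) ^ shift_conj (f x1) (f y).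
Proof.
rewrite GA_relatorsP -trefoil_relations_elim phiA_trefoil_x1 phiA_trefoil_x2.
by rewrite !(gmulfM, gmulfV, gmulfXn).
Qed.

Lemma sd_gen_relators r : GA_relators b r -> free_lift sd_gen r = 1.
Proof.
have genE l : free_lift sd_gen (free_gen l) = sd_gen l by exact: free_lift_gen.
move: r; apply/trefoil_relatorsP => /=.
rewrite (genE X1) (genE X2) (genE Y) /=; split=> //.
rewrite /shift_conj sd_shift_r sd_shift_q -sd_F_shift.
by rewrite -!gmulfV -!gmulfM -gmulfJ /= free_lift_gen.
Qed.

Definition GA_to_sd : {hom GA b -> S} := quo_lift sd_gen_relators.

Local Notation pi := (quo_pi (GA_relators b)).

Definition sd_to_GA_gen (l : F3_letter) : GA b :=
  match l with
  | X1 => pi y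
  | X2 => shift_q (pi x1) (pi y)
  | Y => shift_r (pi x1) (pi y)
  end.

Definition sd_to_GA_F : {hom F3 -> GA b} := free_lift sd_to_GA_gen.

Lemma sd_to_GA_F_gen l : sd_to_GA_F (free_gen l) = sd_to_GA_gen l.
Proof. exact: free_lift_gen. Qed.

Definition sd_to_GA_Z : {hom Z -> GA b} := free_lift (fun _ => (pi x1)^-1).

Lemma sd_to_GA_Z_gen : sd_to_GA_Z (free_gen tt) = (pi x1)^-1.
Proof. exact: free_lift_gen. Qed.

Lemma pi_relations :
  pi x2 = trefoil_x2 (pi x1) (pi y) /\
  shift_r (pi x1) (pi y) ^ (pi x1)^-1
    = shift_r (pi x1) (pi y) ^ shift_conj (pi x1) (pi y).
Proof.
apply/trefoil_relatorsP => r br.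
apply/quo_piP; rewrite divg1; apply: gen_in.
by exists r => //; exists 1 => //; rewrite conjg1.
Qed.

Lemma sd_to_GA_shift h f : sd_to_GA_F (shift_act h f) = sd_to_GA_F f ^ sd_to_GA_Z h.
Proof.
elim/free_group_ind: h f => [|[]|h1 h2 IH1 IH2|h IHh] f.
- by rewrite theta1 gmulf1 conjg1.
- rewrite shift_act_gen sd_to_GA_Z_gen.
  elim/free_group_ind: f => [|l|f g IHf IHg|f IHf].
  + by rewrite !gmulf1 conj1g.
  + have [_ rel] := pi_relations.
    have -> : shift (free_gen l) = shift_fun l by exact: free_lift_gen.
    (* For [p] and [q] this is the definition of [shift_q] and [shift_r]; for [r] it is the
       remaining relation of $G(K_1)$. *)
    case: l; rewrite [shift_fun _]/= ?(gmulfJ, gmulfM, gmulfV);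
      rewrite ?(sd_to_GA_F_gen X1) ?(sd_to_GA_F_gen X2) ?(sd_to_GA_F_gen Y).
    * by rewrite mulVKg.
    * by rewrite mulVKg.
    * by rewrite rel.
  + by rewrite autM !gmulfM conjMg IHf IHg.
  + by rewrite autV !gmulfV conjVg IHf.
- by rewrite thetaM IH2 IH1 gmulfM conjgM.
(* The induction hypothesis for [h] is applied to the image of [f] under [h^-1]. *)
- rewrite -{2}[f](theta1 shift_act) -(mulVg h) thetaM IHh.
  by rewrite (gmulfV sd_to_GA_Z) conjgK.
Qed.

Definition sd_to_GA : {hom S -> GA b} := sd_lift sd_to_GA_shift.

(** Both composites are homomorphisms on [F3], so agreement on generators suffices; this left
    inverse gives the injectivity of [GA_to_sd]. *)
Lemma GA_to_sdK : cancel GA_to_sd sd_to_GA.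
Proof.
move=> g; rewrite -[g]quo_piK [GA_to_sd _]quo_liftE.
apply: (free_lift_unique (p := sd_to_GA \o free_lift sd_gen) (q := pi)) => l /=.
rewrite free_lift_gen.
have Ea : sd_to_GA sd_a = pi x1.
  rewrite /sd_a gmulfV; apply: invg_inj; rewrite invgK -sd_to_GA_Z_gen.
  by rewrite /sd_to_GA /= /sd_lift gmulf1 mulg1.
have Ey : sd_to_GA (sd_F x1) = pi y.
  by rewrite /sd_to_GA /= /sd_lift /= gmulf1 mul1g (sd_to_GA_F_gen X1).
case: l => //=; have [-> _] := pi_relations.
by rewrite (gmulf_trefoil_x2 sd_to_GA) Ea Ey.
Qed.

End ToSemidirect.

Theorem corollary4p2 : residually_nilpotent (GA virtual_trefoil_braid).
Proof.
apply: (residually_nilpotent_embed (f := GA_to_sd)).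
(* The generator [y] maps to the free generator [p], so it is nontrivial. *)
- exists (quo_pi _ y) => /(congr1 GA_to_sd).
  rewrite [LHS]quo_liftE gmulf1 [LHS]free_lift_gen => /(congr1 snd).
  exact: free_gen_neq1.
- by move=> g g1; rewrite -[g]GA_to_sdK g1 gmulf1.
- exact: lower_central_residual.
Qed.
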